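(* Let $G$ be a strongly connected $k$-out graph which is totally synchronizing. Then $\operatorname{Aut}(G)$ contains no vertex-rigid automorphism; in particular, $\operatorname{Aut}(G)$ contains no semiregular element.
   Context: A graph is a finite directed multigraph $G=(V,E,s,t)$ with source and target maps $s,t:E\to V$ (loops and parallel edges allowed). It is $k$-out if every vertex has exactly $k$ outgoing edges. An automorphism of $G$ is a pair $\varphi=(\varphi_v,\varphi_e)$ of bijections $V\to V$, $E\to E$ with $s\varphi_e=\varphi_v s$ and $t\varphi_e=\varphi_v t$; $\operatorname{Aut}(G)$ is the group of automorphisms. The identity $\mathrm{id}_G$ is the pair of identity maps (so an automorphism that fixes all vertices but moves some edge is not the identity). A coloring of $G$ is a map $\chi:E\to[k]=\{1,\dots,k\}$ whose restriction to the set of outgoing edges of each vertex is a bijection onto $[k]$. It defines the deterministic complete automaton $\chi(G)=(V,[k],\delta_\chi)$, where $\delta_\chi(v,a)=t(e)$ for the unique edge $e$ with $s(e)=v$, $\chi(e)=a$. The automaton is synchronizing if there is a word $w\in[k]^*$ with $|V\cdot w|=1$. $G$ is totally synchronizing if $\chi(G)$ is synchronizing for every coloring $\chi$ of $G$. A nontrivial (i.e. $\neq\mathrm{id}_G$) automorphism $\varphi$ is vertex-rigid if for every vertex $v$ and every $m>0$, $\varphi^m(v)=v$ implies $\varphi^m(e)=e$ for all edges $e$ with source $v$. A nontrivial automorphism $\varphi$ is semiregular if for every $m>0$, $\varphi^m\ne\mathrm{id}_G$ implies that $\varphi^m$ fixes no vertex. *)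

(* Defs.v *)
From mathcomp Require Import all_boot all_fingroup.

Set Implicit Arguments.
Unset Strict Implicit.
Unset Printing Implicit Defensive.

Local Open Scope group_scope.

Record digraph := Digraph {
  vertex : finType;
  edge : finType;
  src : edge -> vertex;
  tgt : edge -> vertex
}.

Section Graphs.
Variable G : digraph.

Definition out_edges (v : vertex G) : {set edge G} := [set e | src e == v].

Definition k_out (k : nat) : Prop := forall v : vertex G, #|out_edges v| = k.

Definition adj : rel (vertex G) :=
  fun u v => [exists e : edge G, (src e == u) && (tgt e == v)].

Definition strongly_connected : Prop := forall u v : vertex G, connect adj u v.

(* Pairs of permutations form a finGroupType (the direct product); its unit is
   the pair of identity maps.  Products in {perm _} compose from left to right,
   which does not affect powers. *)
Definition Aut_graph : {set {perm vertex G} * {perm edge G}} :=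
  [set phi : {perm vertex G} * {perm edge G} | [forall e : edge G,
     (src (phi.2 e) == phi.1 (src e)) && (tgt (phi.2 e) == phi.1 (tgt e))]].

Lemma Aut_graphP (phi : {perm vertex G} * {perm edge G}) :
  reflect ((forall e, src (phi.2 e) = phi.1 (src e)) /\
           (forall e, tgt (phi.2 e) = phi.1 (tgt e)))
          (phi \in Aut_graph).
Proof.
rewrite inE; apply: (iffP forallP) => [H|[Hs Ht] e].
  by split=> e; case/andP: (H e) => /eqP ? /eqP ?.
by rewrite Hs Ht !eqxx.
Qed.

Lemma Aut_graph_group_set : group_set Aut_graph.
Proof.
apply/group_setP; split=> [|x y /Aut_graphP [xs xt] /Aut_graphP [ys yt]].
  by apply/Aut_graphP; split=> e; rewrite !perm1.
by apply/Aut_graphP; split=> e /=; rewrite !permM ?ys ?xs ?yt ?xt.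
Qed.

Canonical Aut_graph_group := Group Aut_graph_group_set.

Definition vertex_rigid (phi : {perm vertex G} * {perm edge G}) : Prop :=
  phi <> 1 /\
  forall (v : vertex G) (m : nat), 0 < m -> (phi ^+ m).1 v = v ->
    forall e : edge G, src e = v -> (phi ^+ m).2 e = e.

Definition semiregular_aut (phi : {perm vertex G} * {perm edge G}) : Prop :=
  phi <> 1 /\
  forall m : nat, 0 < m -> phi ^+ m <> 1 ->
    forall v : vertex G, (phi ^+ m).1 v <> v.

End Graphs.

Record automaton (A : finType) := Automaton {
  state : finType;
  trans : state -> A -> state
}.

Section Automata.
Variables (A : finType) (M : automaton A).

Definition run (q : state M) (w : seq A) : state M := foldl (@trans A M) q w.

Definition synchronizing : Prop :=
  exists w : seq A, #|[set run q w | q : state M]| = 1%N.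

End Automata.

(* The colour set {1, ..., k} is represented by 'I_k. *)
Record coloring (G : digraph) (k : nat) := Coloring {
  color :> edge G -> 'I_k;
  color_inj : forall v : vertex G, {in out_edges v &, injective color};
  color_surj : forall v : vertex G, color @: out_edges v = [set: 'I_k]
}.

Section ColoredAutomaton.
Variables (G : digraph) (k : nat) (chi : coloring G k).

Lemma color_edge_exists (v : vertex G) (a : 'I_k) :
  exists e : edge G, (src e == v) && (chi e == a).
Proof.
have : a \in chi @: out_edges v by rewrite color_surj inE.
by case/imsetP=> e; rewrite inE => se ->; exists e; rewrite se eqxx.
Qed.

Definition color_edge (v : vertex G) (a : 'I_k) : edge G :=
  xchoose (color_edge_exists v a).

Lemma color_edge_unique (e : edge G) : color_edge (src e) (chi e) = e.
Proof.
case/andP: (xchooseP (color_edge_exists (src e) (chi e))) => se /eqP ce.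
by apply: (color_inj (v := src e)) ce; rewrite inE.
Qed.

Definition color_automaton : automaton 'I_k :=
  @Automaton 'I_k (vertex G) (fun v a => tgt (color_edge v a)).

End ColoredAutomaton.

Definition totally_synchronizing (G : digraph) (k : nat) : Prop :=
  forall chi : coloring G k, synchronizing (color_automaton chi).

(* Main.v *)
(** If phi is vertex-rigid, a coloring of one vertex per phi-orbit can be
    transported along the orbits without conflict, giving a phi-invariant
    coloring. Then phi acts as an automorphism of the resulting automaton, so
    it fixes the state reached by any synchronizing word. Rigidity spreads a
    fixed vertex to its outgoing edges and their targets, hence by strong
    connectivity to the whole graph, so phi is the identity. *)
Require Import Defs.
From mathcomp Require Import all_boot all_fingroup.

Set Implicit Arguments.
Unset Strict Implicit.
Unset Printing Implicit Defensive.

Local Open Scope group_scope.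

Lemma expg_fst (gT hT : finGroupType) (x : gT * hT) n : (x ^+ n).1 = x.1 ^+ n.
Proof. by elim: n => [|n IHn] //; rewrite !expgS -IHn. Qed.

Lemma expg_snd (gT hT : finGroupType) (x : gT * hT) n : (x ^+ n).2 = x.2 ^+ n.
Proof. by elim: n => [|n IHn] //; rewrite !expgS -IHn. Qed.

(** A power fixing a vertex must be the identity, hence fixes every edge. *)
Lemma semiregular_vertex_rigid (G : digraph)
    (phi : {perm vertex G} * {perm edge G}) :
  semiregular_aut phi -> vertex_rigid phi.
Proof.
case=> phi1 semi; split=> // v m m_gt0 fix_v e _.
have [->|/eqP nt] := eqVneq (phi ^+ m) 1; first by rewrite perm1.
by case: (semi m m_gt0 nt v).
Qed.

Section InvariantColoring.
Variables (G : digraph) (k : nat) (phi : {perm vertex G} * {perm edge G}).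
Hypotheses (kG : k_out G k) (Aphi : phi \in Aut_graph G).
Hypothesis rigid : vertex_rigid phi.

Let f := phi.1.
Let g := phi.2.

Lemma src_iter n e : src (iter n g e) = iter n f (src e).
Proof.
by case/Aut_graphP: Aphi => sE _; elim: n => //= n <-; rewrite sE.
Qed.

Lemma rigid_fix m v e :
  0 < m -> iter m f v = v -> src e = v -> iter m g e = e.
Proof.
case: rigid => _ R m_gt0 fix_v se.
rewrite -permX -expg_snd; apply: (R v) => //.
by rewrite expg_fst permX.
Qed.

(** This is the absence of conflict: where [e] is carried depends only on where its source lands,
    not on how often the cycle was traversed. The surplus [b - a] steps fix the source of
    [iter a g e], so rigidity applies there. *)
Lemma rigid_iter_eq a b e :
  iter a f (src e) = iter b f (src e) -> iter a g e = iter b g e.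
Proof.
wlog le_ab : a b / a <= b.
  move=> W eq_ab; case/orP: (leq_total a b) => le_ab; first exact: W.
  by apply/esym/W.
rewrite -(subnK le_ab) !iterD.
case: (posnP (b - a)) => [->//|ba_gt0] fixE.
by rewrite (rigid_fix ba_gt0 (esym fixE)) ?src_iter.
Qed.

(** [froot] picks one vertex per [f]-orbit; [rep] pushes an edge along its orbit until it leaves
    that vertex. *)
Let steps v := findex f v (froot f v).
Let rep e := iter (steps (src e)) g e.

Lemma src_rep e : src (rep e) = froot f (src e).
Proof. by rewrite src_iter iter_findex ?connect_root. Qed.

Lemma rep_invariant e : rep (g e) = rep e.
Proof.
rewrite /rep -iterSr; apply: rigid_iter_eq.
have sg : src (g e) = f (src e) by case/Aut_graphP: Aphi.
rewrite iterSr -sg !iter_findex ?connect_root // sg.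
have symf := fconnect_sym (@perm_inj _ f).
by apply/eqP; rewrite eq_sym root_connect // fconnect1.
Qed.

Lemma rep_inj e e' : src e = src e' -> rep e = rep e' -> e = e'.
Proof. by rewrite /rep => ->; rewrite -!permX; apply: perm_inj. Qed.

(** The edges leaving a root are coloured in enumeration order, all others through [rep]. *)
Let rank e := index (rep e) (enum (out_edges (src (rep e)))).

Lemma mem_rep e : rep e \in enum (out_edges (src (rep e))).
Proof. by rewrite mem_enum inE. Qed.

Lemma rank_lt e : rank e < k.
Proof. by rewrite -(kG (src (rep e))) cardE index_mem mem_rep. Qed.

Let col e := Ordinal (rank_lt e).

Lemma col_inj v : {in out_edges v &, injective col}.
Proof.
move=> e e'; rewrite !inE => /eqP se /eqP se' /(congr1 val) /= rE.
apply: rep_inj; first by rewrite se se'.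
(* Equal sources share a root, so both ranks are positions in the same list. *)
have srE : src (rep e) = src (rep e') by rewrite !src_rep se se'.
move: rE; rewrite /rank srE => /(index_inj e); apply; last exact: mem_rep.
by rewrite -srE mem_rep.
Qed.

Lemma col_surj v : col @: out_edges v = [set: 'I_k].
Proof.
apply/eqP; rewrite eqEcard subsetT cardsT card_ord.
by rewrite (card_in_imset (@col_inj v)) kG leqnn.
Qed.

Lemma invariant_coloring :
  exists chi : coloring G k, forall e, chi (phi.2 e) = chi e.
Proof.
exists (Coloring col_inj col_surj) => e /=.
by apply: val_inj; rewrite /= /rank rep_invariant.
Qed.

End InvariantColoring.

Lemma run_automorphism (G : digraph) (k : nat) (chi : coloring G k)
    (phi : {perm vertex G} * {perm edge G}) (w : seq 'I_k) (q : vertex G) :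
  phi \in Aut_graph G -> (forall e, chi (phi.2 e) = chi e) ->
  run (M := color_automaton chi) (phi.1 q) w =
    phi.1 (run (M := color_automaton chi) q w).
Proof.
case/Aut_graphP=> sE tE cE; rewrite /run; elim: w q => //= a w IHw q.
rewrite -IHw; congr (foldl _ _ _).
have /andP[/eqP se /eqP ce] := xchooseP (color_edge_exists chi q a).
rewrite -/(color_edge chi q a) in se ce *.
(* With [q] and [a] read off from [e], the edge of the same colour at [phi.1 q] is [phi.2 e]. *)
move: (color_edge chi q a) se ce => e <- <-.
by rewrite -tE -sE -cE color_edge_unique.
Qed.

Lemma vertex_rigid_no_fixpoint (G : digraph)
    (phi : {perm vertex G} * {perm edge G}) (p : vertex G) :
  strongly_connected G -> phi \in Aut_graph G -> vertex_rigid phi ->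
  phi.1 p <> p.
Proof.
move=> sc /Aut_graphP[_ tE] [nt rigid] fix_p; apply: nt.
have fixE v : phi.1 v = v -> forall e, src e = v -> phi.2 e = e.
  by move=> fix_v; apply: (rigid v 1%N).
have fixV v : phi.1 v = v.
  have /connectP[s] := sc p v.
  elim: s p fix_p => [|y s IHs] x fix_x /=; first by move=> _ ->.
  case/andP=> /existsP[e /andP[/eqP se /eqP te]]; apply: IHs.
  by rewrite -te -tE (fixE x).
(* Once all vertices are fixed, each edge is fixed because its source is. *)
apply: injective_projections; apply/permP => x; rewrite perm1 ?fixV //.
exact: (fixE (src x)).
Qed.

Lemma totally_synchronizing_not_rigid (G : digraph) (k : nat)
    (phi : {perm vertex G} * {perm edge G}) :
  strongly_connected G -> k_out G k -> totally_synchronizing G k ->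
  phi \in Aut_graph G -> ~ vertex_rigid phi.
Proof.
move=> sc kG ts Aphi rigid.
have [chi chiE] := invariant_coloring kG Aphi rigid.
have [w /eqP/cards1P[p imE]] := ts chi.
have runE q : run (M := color_automaton chi) q w = p.
  by apply/set1P; rewrite -imE imset_f.
apply: (vertex_rigid_no_fixpoint (p := p) sc Aphi rigid).
(* The runs of [w] from [p] and from [phi.1 p] both end at [p], while [phi.1] maps the first end to
   the second. *)
by rewrite -{1}(runE p) -run_automorphism.
Qed.

Theorem theorem3p9 (G : digraph) (k : nat) :
  strongly_connected G -> k_out G k -> totally_synchronizing G k ->
  ~ (exists2 phi, phi \in Aut_graph G & vertex_rigid phi) /\
  ~ (exists2 phi, phi \in Aut_graph G & semiregular_aut phi).
Proof.
move=> sc kG ts; split=> [[phi Aphi rigid]|[phi Aphi semi]].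
  exact: (totally_synchronizing_not_rigid sc kG ts Aphi rigid).
apply: (totally_synchronizing_not_rigid sc kG ts Aphi).
exact: semiregular_vertex_rigid.
Qed.
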